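(* Let $u_1,u_2,u_3,u_4,\alpha,\beta,q$ be indeterminates and let $x,y$ be such that $x+y=u_3+u_4$ and $xy=u_1u_2$. For $n\ge 1$ let $$P_n(u_1,u_2,u_3,u_4|\alpha,\beta;q):=\sum_{\sigma\in\mathfrak{S}_n}u_1^{\mathrm{V}(\sigma)}u_2^{\mathrm{M}(\sigma)-1}u_3^{\mathrm{da}(\sigma)}u_4^{\mathrm{dd}(\sigma)}\alpha^{\mathrm{lma}(\sigma)-1}\beta^{\mathrm{rma}(\sigma)-1}q^{\mathrm{inv}(\sigma)},$$ and let $$F(x,y,u,q;t):=u_1\frac{\exp_q((x-u)t)-\exp_q((y-u)t)}{x\exp_q((y-u)t)-y\exp_q((x-u)t)}.$$ Then $$\sum_{n\ge 0}P_{n+1}(u_1,u_2,u_3,u_4|\alpha,\beta;q)\frac{t^n}{[n]_q!}=\prod_{k=0}^{\infty}G_k(x,y,u_1,u_2,u_3,u_4;t),$$ where $$G_k(x,y,u_1,u_2,u_3,u_4;t):=\Big[1-t\alpha q^k(1-q)\big(u_3+u_2F(x,y,u_4,q;tq^{k+1})\big)\Big]^{-1}\Big[1-\frac{t\beta}{q^k}(q-1)\big(u_4+u_2F(x,y,u_3,\tfrac1q;\tfrac{t}{q^k})\big)\Big]^{-1}.$$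
   Context: $\mathfrak{S}_n$ is the set of permutations $\sigma=\sigma_1\cdots\sigma_n$ of $[n]=\{1,\dots,n\}$. With the boundary convention $\sigma_0=\sigma_{n+1}=0$, an index $i\in[n]$ is a peak if $\sigma_{i-1}<\sigma_i>\sigma_{i+1}$, a valley if $\sigma_{i-1}>\sigma_i<\sigma_{i+1}$, a double ascent if $\sigma_{i-1}<\sigma_i<\sigma_{i+1}$, a double descent if $\sigma_{i-1}>\sigma_i>\sigma_{i+1}$; $\mathrm{M}(\sigma),\mathrm{V}(\sigma),\mathrm{da}(\sigma),\mathrm{dd}(\sigma)$ denote their numbers. $\mathrm{lma}(\sigma)$ (resp. $\mathrm{rma}(\sigma)$) is the number of left-to-right maxima (resp. right-to-left maxima), i.e. entries $\sigma_i$ larger than all entries to their left (resp. right). $\mathrm{inv}(\sigma)=|\{(i,j):i<j,\sigma_i>\sigma_j\}|$. $[n]_q!=\prod_{i=1}^n(1+q+\cdots+q^{i-1})$ and $\exp_q(t)=\sum_{n\ge0}t^n/[n]_q!$.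
   Formalization: The product of the G_k converges in no single topology, so it is read as the product over k of the first (alpha) factors, converging at q = 0, times the product over k of the second (beta) factors, converging at q = infinity; x and y are taken distinct, as holds for indeterminates. *)

(* Defs.v *)
From HB Require Import structures.
From mathcomp Require Import all_boot all_order all_fingroup all_algebra.
From mathcomp Require Import boolp.
Set Implicit Arguments.
Unset Strict Implicit.
Unset Printing Implicit Defensive.
Import GRing.Theory.
Local Open Scope ring_scope.

(* Formal power series in one variable t.  Multiplication is the Cauchy
   product; over a field a series is a unit iff its constant term is nonzero. *)
Record fps (R : Type) := Fps { coefs : nat -> R }.

Lemma fpsP (R : Type) (f g : fps R) : coefs f =1 coefs g -> f = g.
Proof. by case: f g => [f] [g] /= /funext ->. Qed.

HB.instance Definition _ (R : Type) := gen_eqMixin (fps R).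
HB.instance Definition _ (R : Type) := gen_choiceMixin (fps R).

Section FpsRing.
Variable R : comNzRingType.
Implicit Types f g h : fps R.

Definition fps_zero : fps R := Fps (fun=> 0).
Definition fps_add f g := Fps (fun n => coefs f n + coefs g n).
Definition fps_opp f := Fps (fun n => - coefs f n).
Definition fps_one : fps R := Fps (fun n => (n == 0%N)%:R).
Definition fps_mul f g :=
  Fps (fun n => \sum_(i < n.+1) coefs f i * coefs g (n - i)%N).

Fact fps_addA : associative fps_add.
Proof. by move=> f g h; apply: fpsP => n /=; rewrite addrA. Qed.
Fact fps_addC : commutative fps_add.
Proof. by move=> f g; apply: fpsP => n /=; rewrite addrC. Qed.
Fact fps_add0 : left_id fps_zero fps_add.
Proof. by move=> f; apply: fpsP => n /=; rewrite add0r. Qed.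
Fact fps_addN : left_inverse fps_zero fps_opp fps_add.
Proof. by move=> f; apply: fpsP => n /=; rewrite addNr. Qed.

HB.instance Definition _ := GRing.isZmodule.Build (fps R)
  fps_addA fps_addC fps_add0 fps_addN.

Definition fps_trunc (N : nat) f : {poly R} := \poly_(i < N) coefs f i.

Lemma coef_fps_mul N n f g : (n < N)%N ->
  coefs (fps_mul f g) n = (fps_trunc N f * fps_trunc N g)`_n.
Proof.
move=> nN; rewrite coefM; apply: eq_bigr => i _.
by rewrite !coef_poly (leq_trans (ltn_ord i) nN) (leq_ltn_trans (leq_subr _ _) nN).
Qed.

Lemma coef_fps_mul3 n f g h :
  coefs (fps_mul (fps_mul f g) h) n =
  (fps_trunc n.+1 f * fps_trunc n.+1 g * fps_trunc n.+1 h)`_n.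
Proof.
rewrite coefM; apply: eq_bigr => i _.
rewrite (@coef_fps_mul n.+1) //; congr (_ * _).
by rewrite coef_poly ltnS leq_subr.
Qed.

Fact fps_mulC : commutative fps_mul.
Proof.
move=> f g; apply: fpsP => n.
by rewrite !(@coef_fps_mul n.+1) // mulrC.
Qed.
Fact fps_mulA : associative fps_mul.
Proof.
move=> f g h; apply: fpsP => n.
rewrite fps_mulC !coef_fps_mul3; congr (_`_n).
by rewrite mulrC mulrA.
Qed.
Fact fps_mul1 : left_id fps_one fps_mul.
Proof.
move=> f; apply: fpsP => n /=.
rewrite big_ord_recl /= mul1r subn0 big1 ?addr0 // => i _.
by rewrite mul0r.
Qed.
Fact fps_mulD : left_distributive fps_mul +%R.
Proof.
move=> f g h; apply: fpsP => n /=.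
by rewrite -big_split; apply: eq_bigr => i _ /=; rewrite mulrDl.
Qed.
Fact fps_one_neq0 : fps_one != 0.
Proof.
by apply/eqP => /(congr1 (fun f => coefs f 0%N)) /= /eqP; rewrite oner_eq0.
Qed.

HB.instance Definition _ := GRing.Zmodule_isComNzRing.Build (fps R)
  fps_mulA fps_mulC fps_mul1 fps_mulD fps_one_neq0.

Lemma coefsM f g n :
  coefs (f * g) n = \sum_(i < n.+1) coefs f i * coefs g (n - i)%N.
Proof. by []. Qed.

Definition fpsC (c : R) : fps R := Fps (fun n => c *+ (n == 0%N)).
Definition fpsX : fps R := Fps (fun n => (n == 1%N)%:R).

(* f(ct) *)
Definition dilate (c : R) f : fps R := Fps (fun n => c ^+ n * coefs f n).

End FpsRing.

Notation "c %:S" := (fpsC c) (at level 2, left associativity, format "c %:S").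

Section FpsInv.
Variable L : fieldType.
Implicit Types f g : fps L.

(* g = 1/f is determined by g_0 = 1/f_0 and
   g_n = - (1/f_0) * \sum_(i < n) f_(n-i) g_i; [fps_invs f n] lists
   g_0, ..., g_n. *)
Fixpoint fps_invs f (n : nat) : seq L :=
  if n is m.+1 then
    let s := fps_invs f m in
    rcons s (- (coefs f 0%N)^-1 * \sum_(i < n) coefs f (n - i)%N * s`_i)
  else [:: (coefs f 0%N)^-1].

Definition fps_unit : {pred fps L} := [pred f | coefs f 0%N != 0].
Definition fps_inv f : fps L :=
  if f \in fps_unit then Fps (fun n => (fps_invs f n)`_n) else f.

Lemma size_fps_invs f n : size (fps_invs f n) = n.+1.
Proof. by elim: n => //= n IH; rewrite size_rcons IH. Qed.

Lemma nth_fps_invs f n i : (i <= n)%N -> (fps_invs f n)`_i = (fps_invs f i)`_i.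
Proof.
elim: n => [|n IH]; first by rewrite leqn0 => /eqP ->.
rewrite leq_eqVlt => /orP [/eqP -> //|lt_in].
by rewrite /= nth_rcons size_fps_invs lt_in IH.
Qed.

Fact fps_mulV : {in fps_unit, left_inverse 1 fps_inv *%R}.
Proof.
move=> f uf; rewrite mulrC; apply: fpsP => n.
rewrite /fps_inv uf coefsM /=; move: uf; rewrite inE => f0.
case: n => [|n]; first by rewrite big_ord1 /= mulfV.
rewrite big_ord_recl subn0 /= nth_rcons size_fps_invs ltnn eqxx.
rewrite mulNr mulrN mulrA mulfV // mul1r addrC; apply/eqP.
rewrite subr_eq0; apply/eqP.
rewrite (reindex_inj rev_ord_inj) /=; apply: eq_bigr => i _.
have le_in : (i <= n)%N by rewrite -ltnS.
rewrite /bump /= add1n !subSS subKn // -subSn //.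
by rewrite [in RHS]nth_fps_invs.
Qed.

Fact fps_unitPl f g : g * f = 1 -> fps_unit f.
Proof.
move=> /(congr1 (fun h => coefs h 0%N)); rewrite coefsM big_ord1 /= => gf1.
by apply: contra_eq_neq gf1 => ->; rewrite mulr0 eq_sym oner_neq0.
Qed.

Fact fps_inv_out : {in [predC fps_unit], fps_inv =1 id}.
Proof. by move=> f; rewrite inE /fps_inv => /negPf ->. Qed.

HB.instance Definition _ := GRing.ComNzRing_hasMulInverse.Build (fps L)
  fps_mulV fps_unitPl fps_inv_out.
End FpsInv.

Section PermutationStatistics.
Variables (n : nat) (s : {perm 'I_n}).
Local Open Scope nat_scope.

(* [entry i] is sigma_i for the word sigma_1 ... sigma_n on {1, ..., n}, with
   sigma_0 = sigma_(n+1) = 0 (0 is also the default value of [nth]).  In the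
   statistics below an ordinal i : 'I_n stands for the position i + 1. *)
Definition entry (i : nat) : nat :=
  nth 0 (0 :: [seq (s j).+1 | j <- enum 'I_n]) i.

Definition peaks := #|[set i : 'I_n |
  (entry i < entry i.+1) && (entry i.+1 > entry i.+2)]|.
Definition valleys := #|[set i : 'I_n |
  (entry i > entry i.+1) && (entry i.+1 < entry i.+2)]|.
Definition dascents := #|[set i : 'I_n |
  (entry i < entry i.+1) && (entry i.+1 < entry i.+2)]|.
Definition ddescents := #|[set i : 'I_n |
  (entry i > entry i.+1) && (entry i.+1 > entry i.+2)]|.

Definition lma := #|[set i : 'I_n | [forall j : 'I_n, (j < i) ==> (s j < s i)]]|.
Definition rma := #|[set i : 'I_n | [forall j : 'I_n, (i < j) ==> (s j < s i)]]|.
Definition inv := #|[set p : 'I_n * 'I_n | (p.1 < p.2) && (s p.1 > s p.2)]|.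

End PermutationStatistics.

Section GeneratingFunctions.
Variable L : fieldType.
Implicit Types q u x y : L.

(* The exponents [_.-1] are genuine predecessors when 0 < n. *)
Definition P (n : nat) (u1 u2 u3 u4 a b q : L) : L :=
  \sum_(s : {perm 'I_n})
     u1 ^+ valleys s * u2 ^+ (peaks s).-1 * u3 ^+ dascents s
   * u4 ^+ ddescents s * a ^+ (lma s).-1 * b ^+ (rma s).-1 * q ^+ inv s.

Definition qfact q (n : nat) : L :=
  \prod_(1 <= i < n.+1) \sum_(0 <= j < i) q ^+ j.

Definition expq q : fps L := Fps (fun n => (qfact q n)^-1).

Definition F (u1 x y u q : L) : fps L :=
  let Ex := dilate (x - u) (expq q) in
  let Ey := dilate (y - u) (expq q) in
  u1%:S * (Ex - Ey) / (x%:S * Ey - y%:S * Ex).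

(* The two factors of G_k.  The product of the first ones converges q-adically
   and that of the second ones q^-1-adically (there is no common topology), so
   prod_k G_k is the product of these two limits. *)
Definition Ga (u1 u2 u3 u4 x y a q : L) (k : nat) : fps L :=
  (1 - fpsX L * (a * q ^+ k * (1 - q))%:S
       * (u3%:S + u2%:S * dilate (q ^+ k.+1) (F u1 x y u4 q)))^-1.

Definition Gb (u1 u2 u3 u4 x y b q : L) (k : nat) : fps L :=
  (1 - fpsX L * (b / q ^+ k * (q - 1))%:S
       * (u4%:S + u2%:S * dilate (q ^- k) (F u1 x y u3 q^-1)))^-1.

End GeneratingFunctions.

(* K(q), with constants embedded by [cst] and indeterminate [qvar]. *)
Section RationalFunctions.
Variable K : fieldType.
Local Notation Kq := {fraction {poly K}}.

Definition cst (c : K) : Kq := tofrac c%:P.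
HB.instance Definition _ := GRing.RMorphism.copy cst (@tofrac {poly K} \o polyC).

Definition qvar : Kq := tofrac 'X.

(* For r = qvar (resp. r = qvar^-1), [adic_small r m z] says that z vanishes to
   order at least m at the place q = 0 (resp. q = oo) of K(q), i.e. that z
   belongs to r^m * K[r]_(r). *)
Definition adic_small (r : Kq) (m : nat) (z : Kq) : Prop :=
  exists c d : {poly K}, d.[0] != 0 /\
    z = r ^+ m * ((map_poly cst c).[r] / (map_poly cst d).[r]).

(* prod_(k >= 0) f_k = g, coefficientwise in t, for the r-adic topology on
   K(q); this topology is separated, so g is unique. *)
Definition is_infprod (r : Kq) (f : nat -> fps Kq) (g : fps Kq) : Prop :=
  forall n m : nat, exists N0 : nat, forall N : nat, (N0 <= N)%N ->
    adic_small r m (coefs (\prod_(k < N) f k) n - coefs g n).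

End RationalFunctions.

Arguments qvar {K}.

(* Main.v *)
(** The statistics of a permutation are recorded by its up-down word, the word
    of ascents and descents of sigma_0 sigma_1 ... sigma_(n+1).  Inserting a new
    minimum at position i adds i inversions, changes only the letter of the gap
    that is hit, and creates a new left-to-right (right-to-left) maximum exactly
    at the first (last) gap.  Since M = V + 1, the weight only sees
    u1 u2 = x y.  Attach to every letter a series in t that enumerates all that
    later insertions can make of it: the first letter gets A, the last one B, an
    inner one either stays or becomes C.  As the letter j is dilated by q^j, the
    product rule of the q-derivative qD f(t) = (f(qt) - f(t)) / ((q - 1) t)
    shows that the product of these series is compatible with insertion as soon
    as
      qD C = xy + u4 C(qt) + u3 C + C C(qt),
      qD A = alpha A (u3 + C(qt)),   qD B = beta B(qt) (u4 + C).
    The generating function is then A(t) B(qt).  The q-Riccati equation is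
    solved by C = u2 F(x,y,u4,q;t) and also, by uniqueness, by
    u2 F(x,y,u3,1/q;t).  By the two linear equations, A(t) / A(qt) and
    B(qt) / B(t) are the two factors of G_0, and iterating gives the infinite
    products. *)
Require Import Defs.
From HB Require Import structures.
From mathcomp Require Import all_boot all_order all_fingroup all_algebra.
From mathcomp Require Import boolp ring zify.
Set Implicit Arguments.
Unset Strict Implicit.
Unset Printing Implicit Defensive.
Import GRing.Theory.
Local Open Scope ring_scope.

(** * Power series and the q-derivative *)

Section Series.
Variable L : fieldType.
Implicit Types (f g : fps L) (c d : L).

Lemma coefsD f g n : coefs (f + g) n = coefs f n + coefs g n.
Proof. by []. Qed.

Lemma coefsB f g n : coefs (f - g) n = coefs f n - coefs g n.
Proof. by []. Qed.

Lemma coefs0M f g : coefs (f * g) 0 = coefs f 0 * coefs g 0.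
Proof. by rewrite coefsM big_ord1. Qed.

Lemma coefsCM c f n : coefs (c%:S * f) n = c * coefs f n.
Proof.
rewrite coefsM big_ord_recl subn0 big1 ?addr0 // => i _.
by rewrite /= mul0r.
Qed.

Lemma coefsXM f n : coefs (fpsX L * f) n.+1 = coefs f n.
Proof.
rewrite coefsM big_ord_recl mul0r add0r big_ord_recl mul1r subSS subn0.
by rewrite big1 ?addr0 // => i _; rewrite /= mul0r.
Qed.

Fact fpsC_is_additive : zmod_morphism (@fpsC L).
Proof. by move=> c d; apply: fpsP => n /=; rewrite mulrnBl. Qed.
Fact fpsC_is_monoid : monoid_morphism (@fpsC L).
Proof.
split=> [|c d]; apply: fpsP => n //.
by rewrite coefsCM /= mulrnAr.
Qed.
HB.instance Definition _ := GRing.isZmodMorphism.Build L (fps L) (@fpsC L)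
  fpsC_is_additive.
HB.instance Definition _ := GRing.isMonoidMorphism.Build L (fps L) (@fpsC L)
  fpsC_is_monoid.

Fact dilate_is_additive c : zmod_morphism (@dilate L c).
Proof. by move=> f g; apply: fpsP => n /=; rewrite mulrBr. Qed.
Fact dilate_is_monoid c : monoid_morphism (@dilate L c).
Proof.
split=> [|f g]; apply: fpsP => n.
  by case: n => [|n] /=; rewrite ?expr0 ?mul1r ?mulr0.
rewrite coefsM /= mulr_sumr; apply: eq_bigr => i _ /=.
have /subnKC Ei : (i <= n)%N by rewrite -ltnS.
by rewrite -{1}Ei exprD mulrACA.
Qed.
HB.instance Definition _ c := GRing.isZmodMorphism.Build (fps L) (fps L)
  (@dilate L c) (dilate_is_additive c).
HB.instance Definition _ c := GRing.isMonoidMorphism.Build (fps L) (fps L)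
  (@dilate L c) (dilate_is_monoid c).

Lemma dilateC c d : dilate c d%:S = d%:S.
Proof. by apply: fpsP => -[|n] /=; rewrite ?expr0 ?mul1r ?mulr0. Qed.

Lemma dilateX c : dilate c (fpsX L) = c%:S * fpsX L.
Proof.
apply: fpsP => n; rewrite coefsCM /=.
by case: n => [|[|n]] //=; rewrite ?mulr0.
Qed.

Lemma dilate_comp c d f : dilate c (dilate d f) = dilate (c * d) f.
Proof. by apply: fpsP => n /=; rewrite exprMn mulrA. Qed.

Lemma dilate1 f : dilate 1 f = f.
Proof. by apply: fpsP => n /=; rewrite expr1n mul1r. Qed.

Lemma fps_unitE f : (f \is a GRing.unit) = (coefs f 0 != 0).
Proof. by []. Qed.

End Series.

Section QDerivative.
Variables (L : fieldType) (q : L).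
Hypothesis q_neq1 : forall n, q ^+ n.+1 != 1.
Implicit Types (f g : fps L) (c : L).
Local Notation X := (fpsX L).

Definition qnum (n : nat) : L := \sum_(0 <= j < n) q ^+ j.

Lemma qnumE n : (q - 1) * qnum n = q ^+ n - 1.
Proof. by rewrite subrX1 /qnum big_mkord. Qed.

Lemma q1_neq0 : q - 1 != 0.
Proof. by rewrite subr_eq0; exact: q_neq1 0%N. Qed.

Lemma qnum_neq0 n : qnum n.+1 != 0.
Proof.
have: (q - 1) * qnum n.+1 != 0 by rewrite qnumE subr_eq0.
by rewrite mulf_eq0 negb_or => /andP[].
Qed.

Lemma qfactS n : qfact q n.+1 = qfact q n * qnum n.+1.
Proof. by rewrite /qfact big_nat_recr. Qed.

Lemma qfact_neq0 n : qfact q n != 0.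
Proof.
elim: n => [|n IH]; first by rewrite /qfact big_geq ?oner_neq0.
by rewrite qfactS mulf_neq0 ?qnum_neq0.
Qed.

(** The quotient [(f(qt) - f(t)) / ((q - 1) t)], written on coefficients so that no division by t
    occurs. *)
Definition qD f : fps L := Fps (fun n => qnum n.+1 * coefs f n.+1).

Lemma coefs_qD f n : coefs (qD f) n = qnum n.+1 * coefs f n.+1.
Proof. by []. Qed.

Lemma dilate_qD f : dilate q f = f + (q - 1)%:S * X * qD f.
Proof.
apply: fpsP => n; rewrite coefsD -mulrA coefsCM.
case: n => [|n]; first by rewrite coefs0M /= mul0r mulr0 expr0 mul1r addr0.
rewrite coefsXM /= mulrA qnumE; ring.
Qed.

Lemma qX_inj f g : (q - 1)%:S * X * f = (q - 1)%:S * X * g -> f = g.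
Proof.
move=> e; apply: fpsP => n; move/(congr1 (fun h => coefs h n.+1)): e.
by rewrite -!mulrA !coefsCM !coefsXM; apply: mulfI; exact: q1_neq0.
Qed.

Lemma qDM f g : qD (f * g) = qD f * dilate q g + f * qD g.
Proof.
apply: qX_inj.
have e : dilate q f * dilate q g = f * g + (q - 1)%:S * X * qD (f * g).
  by rewrite -rmorphM; exact: dilate_qD.
apply: (addrI (f * g)); rewrite -e [dilate q f]dilate_qD [dilate q g]dilate_qD.
ring.
Qed.

Lemma qDD f g : qD (f + g) = qD f + qD g.
Proof. by apply: fpsP => n; rewrite /= mulrDr. Qed.

Lemma qDB f g : qD (f - g) = qD f - qD g.
Proof. by apply: fpsP => n; rewrite /= mulrBr. Qed.

Lemma qDZ c f : qD (c%:S * f) = c%:S * qD f.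
Proof. by apply: fpsP => n; rewrite coefsCM !coefs_qD coefsCM mulrCA. Qed.

Lemma qD_dilate c f : qD (dilate c f) = c%:S * dilate c (qD f).
Proof. by apply: fpsP => n; rewrite coefsCM /= exprS; ring. Qed.

Lemma qD_expq : qD (expq q) = expq q.
Proof.
apply: fpsP => n /=; rewrite qfactS invfM mulrCA mulfV ?mulr1 //.
exact: qnum_neq0.
Qed.

(* Both N and D below satisfy N(qt) = N + (q-1)t N', so the identity becomes one
   between polynomials in Ex and Ey. *)
Lemma F_qD (x y u3 u4 : L) : x + y = u3 + u4 -> x != y ->
  qD (F (x * y) x y u4 q) =
    (x * y)%:S + u4%:S * dilate q (F (x * y) x y u4 q)
    + u3%:S * F (x * y) x y u4 q
    + F (x * y) x y u4 q * dilate q (F (x * y) x y u4 q).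
Proof.
move=> xyu xy; set C := F _ _ _ _ _.
have Eu3 : u3 = x + y - u4 by rewrite xyu addrK.
pose Ex := dilate (x - u4) (expq q); pose Ey := dilate (y - u4) (expq q).
pose N := (x * y)%:S * (Ex - Ey); pose D := x%:S * Ey - y%:S * Ex.
have qEx : qD Ex = (x - u4)%:S * Ex by rewrite qD_dilate qD_expq.
have qEy : qD Ey = (y - u4)%:S * Ey by rewrite qD_dilate qD_expq.
have qN : qD N = (x * y)%:S * ((x - u4)%:S * Ex - (y - u4)%:S * Ey).
  by rewrite qDZ qDB qEx qEy.
have qd : qD D = x%:S * ((y - u4)%:S * Ey) - y%:S * ((x - u4)%:S * Ex).
  by rewrite qDB !qDZ qEx qEy.
have uD : D \is a GRing.unit.
  (* The constant term of [D] is [x - y]. *)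
  rewrite fps_unitE coefsB !coefsCM /= /qfact big_geq // invr1 !expr0 !mulr1.
  by rewrite subr_eq0.
have CD : C * D = N by rewrite /C /F -/Ex -/Ey -/N -/D divrK.
have uDq : dilate q D \is a GRing.unit.
  by move: uD; rewrite !fps_unitE /= expr0 mul1r.
have CDq : dilate q C * dilate q D = dilate q N by rewrite -rmorphM CD.
have qCD : qD C * dilate q D + C * qD D = qD N by rewrite -qDM CD.
apply: (mulIr uDq); apply: (mulIr uD).
have -> : qD C * dilate q D * D = qD N * D - N * qD D.
  by rewrite -qCD -CD; ring.
have -> : ((x * y)%:S + u4%:S * dilate q C + u3%:S * C + C * dilate q C)
     * dilate q D * D =
   (x * y)%:S * dilate q D * D + u4%:S * dilate q N * D + u3%:S * N * dilate q D
   + N * dilate q N by rewrite -CDq -CD; ring.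
rewrite !dilate_qD qN qd Eu3 /N /D !(rmorphB, rmorphD, rmorphM) /=; ring.
Qed.

Lemma coefs0_F (v x y u : L) : coefs (F v x y u q) 0 = 0.
Proof.
by rewrite /F coefs0M coefsCM coefsB /= !expr0 subrr mulr0 mul0r.
Qed.

End QDerivative.

(** * Linear and Riccati q-equations *)

Section Recursion.
Variables (L : fieldType) (q : L).
Hypothesis q_neq1 : forall n, q ^+ n.+1 != 1.

(** Course-of-values recursion: [w n] lists the coefficients up to index n, and each list extends
    the previous one. *)
Lemma ex_linear_rec (M : nat -> nat -> L) :
  exists f : fps L, coefs f 0 = 1 /\
    forall n, coefs f n.+1 = \sum_(i < n.+1) M n i * coefs f i.
Proof.
pose fix w n : seq L := if n is m.+1
  then rcons (w m) (\sum_(i < m.+1) M m i * (w m)`_i) else [:: 1].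
have sz n : size (w n) = n.+1 by elim: n => //= n IH; rewrite size_rcons IH.
have wE n i : (i <= n)%N -> (w n)`_i = (w i)`_i.
  elim: n => [|n IH]; first by rewrite leqn0 => /eqP ->.
  rewrite leq_eqVlt => /orP [/eqP -> //|lt_in].
  by rewrite /= nth_rcons sz lt_in IH.
exists (Fps (fun n => (w n)`_n)); split=> // n.
rewrite /= nth_rcons sz ltnn eqxx; apply: eq_bigr => i _.
by rewrite wE // -ltnS.
Qed.

Lemma ex_qD_left (S : fps L) : exists f, coefs f 0 = 1 /\ qD q f = f * S.
Proof.
have [f [f0 fE]] :=
  ex_linear_rec (fun n i => (qnum q n.+1)^-1 * coefs S (n - i)%N).
exists f; split=> //; apply: fpsP => n; rewrite coefs_qD fE mulr_sumr coefsM.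
apply: eq_bigr => i _ /=.
by rewrite -mulrA mulVKf ?qnum_neq0 // mulrC.
Qed.

Lemma ex_qD_right (S : fps L) :
  exists f, coefs f 0 = 1 /\ qD q f = dilate q f * S.
Proof.
have [f [f0 fE]] :=
  ex_linear_rec (fun n i => (qnum q n.+1)^-1 * (q ^+ i * coefs S (n - i)%N)).
exists f; split=> //; apply: fpsP => n; rewrite coefs_qD fE mulr_sumr coefsM.
apply: eq_bigr => i _ /=.
by field; exact: qnum_neq0.
Qed.

(** At t^n the left side is a nonzero multiple of the coefficient of index n+1, while the right side
    involves only indices up to n. *)
Lemma qriccati_uniq (v c d : L) (f g : fps L) :
  coefs f 0 = 0 -> coefs g 0 = 0 ->
  qD q f = v%:S + c%:S * dilate q f + d%:S * f + f * dilate q f ->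
  qD q g = v%:S + c%:S * dilate q g + d%:S * g + g * dilate q g ->
  f = g.
Proof.
move=> f0 g0 fE gE; apply: fpsP => n.
elim/ltn_ind: n => -[|n] IH; first by rewrite f0 g0.
apply: (mulfI (qnum_neq0 q_neq1 n)); rewrite -!coefs_qD fE gE.
rewrite !coefsD !coefsCM /= IH //; congr (_ + _).
apply: eq_bigr => i _ /=.
by rewrite !IH // ltnS leq_subr.
Qed.

End Recursion.

(** Replacing t by qt in the Riccati equation for 1/q exchanges the roles of u3 and u4, so both
    series solve one equation with zero constant term. *)
Lemma F_inv (L : fieldType) (q x y u3 u4 : L) :
  (forall n, q ^+ n.+1 != 1) -> q != 0 -> x + y = u3 + u4 -> x != y ->
  F (x * y) x y u3 q^-1 = F (x * y) x y u4 q.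
Proof.
move=> q1 q0 xyu xy.
have qi1 n : q^-1 ^+ n.+1 != 1 by rewrite exprVn invr_eq1.
apply: (@qriccati_uniq _ q q1 (x * y) u4 u3 _ _ _ _ _ (F_qD q1 xyu xy));
  try exact: coefs0_F.
set f := F _ _ _ _ _.
have fE : qD q^-1 f = (x * y)%:S + u3%:S * dilate q^-1 f + u4%:S * f
    + f * dilate q^-1 f by apply: F_qD; rewrite // [u4 + _]addrC.
(* On coefficients this is [[n+1]_q = q^n [n+1]_(1/q)]. *)
have -> : qD q f = dilate q (qD q^-1 f).
  apply: fpsP => n; rewrite /= mulrA; congr (_ * _).
  apply: (mulfI (q1_neq0 q1)); rewrite qnumE.
  have := qnumE q^-1 n.+1; have qn0 : q ^+ n != 0 by rewrite expf_neq0.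
  rewrite exprVn exprS => e.
  have -> : (q - 1) * (q ^+ n * qnum q^-1 n.+1) =
     - (q * q ^+ n) * ((q^-1 - 1) * qnum q^-1 n.+1) by field.
  by rewrite e; field; rewrite q0 qn0.
clearbody f; rewrite fE !(rmorphD, rmorphM) /= !dilateC !dilate_comp.
rewrite mulfV // dilate1.
ring.
Qed.

(** * Series attached to up-down words *)

(* An up-down word is stored without its first letter (always an ascent) and its
   last one (always a descent); [true] is an ascent.  [ins_min c i] inserts a
   new minimum in the i-th gap after the first one. *)
Fixpoint ins_min (c : seq bool) (i : nat) : seq bool :=
  match c, i with
  | [::], _ => [:: false]
  | x :: c', 0 => [:: false, true & c']
  | x :: c', i'.+1 => x :: ins_min c' i'
  end.

Definition insert_min (c : seq bool) (i : nat) : seq bool :=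
  if i is i'.+1 then ins_min c i' else true :: c.

Section UpDownSeries.
Variables (L : fieldType) (q v u3 u4 a b : L) (A B C : fps L).
Hypothesis q_neq1 : forall n, q ^+ n.+1 != 1.
Hypothesis C_qD :
  qD q C = v%:S + u4%:S * dilate q C + u3%:S * C + C * dilate q C.
Hypothesis A_qD : qD q A = A * (a%:S * (u3%:S + dilate q C)).
Hypothesis B_qD : qD q B = dilate q B * (b%:S * (u4%:S + C)).

(** The two letters around an entry tell its type. Peaks weigh 1: as [M - 1 = V], the parameter v,
    later [u1 * u2], accounts for peaks and valleys together. *)
Definition adjw (p x : bool) : L :=
  if p then (if x then u3 else 1) else (if x then v else u4).

(* [p] is the last letter before the part of the word described by [c], and the
   final descent is implicit; a letter that has been hit by an insertion begins
   with a descent, ends with an ascent, and is enumerated by C. *)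
Fixpoint tail_series (p : bool) (c : seq bool) : fps L :=
  if c is x :: c' then
    (adjw p x)%:S * dilate q (tail_series x c')
    + (adjw p false)%:S * C * dilate q (tail_series true c')
  else (adjw p false)%:S * B.

Definition word_series (c : seq bool) : fps L :=
  A * dilate q (tail_series true c).

(** Induction on the word. In the product rule, differentiating C is the insertion in the gap of the
    first letter; differentiating the remaining series falls under the induction hypothesis, with a
    factor q from its dilation. *)
Lemma tail_series_qD p c :
  qD q (tail_series p c) = \sum_(i < (size c).+1)
    (q ^+ i * b ^+ (i == size c :> nat))%:S * tail_series p (ins_min c i).
Proof.
elim: c p => [|x c IH] p.
  rewrite big_ord1 [tail_series _ (ins_min _ _)]/=.
  have -> : q ^+ 0 * b ^+ (0 == 0)%N = b by rewrite mul1r.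
  rewrite -!/(adjw p false) [tail_series p [::]]/= qDZ B_qD !rmorphM rmorph1 /=.
  rewrite !dilateC; ring.
rewrite big_ord_recl.
have -> : \sum_(i < (size c).+1) (q ^+ lift ord0 i
      * b ^+ (lift ord0 i == size (x :: c) :> nat))%:S
      * tail_series p (ins_min (x :: c) (lift ord0 i)) =
    q%:S * ((adjw p x)%:S * dilate q (qD q (tail_series x c))
      + (adjw p false)%:S * C * dilate q (qD q (tail_series true c))).
  rewrite !IH !rmorph_sum !mulr_sumr -big_split mulr_sumr.
  apply: eq_bigr => i _.
  rewrite [tail_series _ _]/= -!/(adjw _ _) lift0 eqSS exprS.
  rewrite !rmorphM /= !dilateC; ring.
rewrite -[tail_series p (x :: c)]/((adjw p x)%:S * dilate q (tail_series x c)
    + (adjw p false)%:S * C * dilate q (tail_series true c)).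
(* The inserted descent and ascent each stay or are hit later; these four cases are the four terms
   of the equation for C. *)
rewrite -[tail_series p (ins_min _ _)]/((adjw p false)%:S
   * dilate q (v%:S * dilate q (tail_series true c)
               + u4%:S * C * dilate q (tail_series true c))
   + (adjw p false)%:S * C
   * dilate q (u3%:S * dilate q (tail_series true c)
               + 1%:S * C * dilate q (tail_series true c))).
rewrite qDD -[_ * C * _]mulrA !qDZ qDM // !qD_dilate C_qD.
rewrite /= !expr0 !(rmorphD, rmorphM, rmorph1) /= !dilateC.
ring.
Qed.

Lemma word_series_qD c :
  qD q (word_series c) = \sum_(i < (size c).+2)
    (q ^+ i * a ^+ (i == 0%N :> nat) * b ^+ (i == (size c).+1 :> nat))%:S
     * word_series (insert_min c i).
Proof.
rewrite big_ord_recl.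
have -> : \sum_(i < (size c).+1) (q ^+ lift ord0 i
      * a ^+ (lift ord0 i == 0%N :> nat)
      * b ^+ (lift ord0 i == (size c).+1 :> nat))%:S
      * word_series (insert_min c (lift ord0 i)) =
    q%:S * (A * dilate q (qD q (tail_series true c))).
  rewrite tail_series_qD !rmorph_sum !mulr_sumr; apply: eq_bigr => i _.
  rewrite lift0 eqSS exprS mulr1 /= /word_series !rmorphM /= !dilateC.
  ring.
rewrite -[word_series (insert_min _ _)]/(A
   * dilate q (u3%:S * dilate q (tail_series true c)
               + 1%:S * C * dilate q (tail_series true c))).
rewrite /word_series qDM // qD_dilate A_qD.
rewrite /= !expr0 !(rmorphD, rmorphM, rmorph1) /= !dilateC.
ring.
Qed.

End UpDownSeries.

(** * Up-down words of permutations *)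

Section Words.
Local Open Scope nat_scope.

Lemma size_ins_min c i : size (ins_min c i) = (size c).+1.
Proof. by elim: c i => [|x c IH] [|i] //=; rewrite IH. Qed.

Lemma size_insert_min c i : size (insert_min c i) = (size c).+1.
Proof. by case: i => [|i] //=; rewrite size_ins_min. Qed.

Lemma nth_ins_min c i k : i <= size c -> k <= size c ->
  nth false (ins_min c i) k =
  if k < i then nth false c k else if k == i then false
  else if k == i.+1 then true else nth false c k.-1.
Proof.
elim: c i k => [|x c IH] [|i] [|k] //=.
  by rewrite !ltnS; case: k => [|[]].
move=> ic kc; rewrite IH //.
by rewrite !ltnS !eqSS; case: ltngtP => //; case: k {kc} => [|k] //.
Qed.

End Words.

Section Entries.
Local Open Scope nat_scope.
Variable n : nat.
Implicit Types (s : 'S_n.+1).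

Lemma entry_ord s (k : 'I_n.+1) : entry s k.+1 = (s k).+1.
Proof.
by rewrite /entry /= (nth_map ord0) ?size_enum_ord ?ltn_ord // nth_ord_enum.
Qed.

Lemma entry_gt s k : n.+1 < k -> entry s k = 0.
Proof.
case: k => // k lt_nk.
by rewrite /entry nth_default //= size_map size_enum_ord.
Qed.

Lemma entry_gt0 s k : (0 < entry s k) = (0 < k <= n.+1).
Proof.
case: k => // k; rewrite ltnS; case: (ltnP k n.+1) => [lt_kn|le_nk].
  by rewrite (entry_ord s (Ordinal lt_kn)).
by rewrite entry_gt.
Qed.

Lemma entry_neq s k : k <= n.+1 -> entry s k != entry s k.+1.
Proof.
case: k => [|k] lt_kn; first by rewrite (entry_ord s ord0).
rewrite (entry_ord s (Ordinal lt_kn)); case: (ltnP k.+1 n.+1) => [lt_kn'|le_nk].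
  rewrite (entry_ord s (Ordinal lt_kn')) eqSS.
  rewrite (inj_eq val_inj) (inj_eq perm_inj) -(inj_eq val_inj) /=.
  by rewrite neq_ltn leqnn.
by rewrite entry_gt.
Qed.

Definition asc s k := entry s k < entry s k.+1.

Lemma ltn_entryS s k : k <= n.+1 -> (entry s k.+1 < entry s k) = ~~ asc s k.
Proof. by move=> /(entry_neq s); rewrite /asc; case: ltngtP. Qed.

Lemma asc0 s : asc s 0.
Proof. by rewrite /asc entry_gt0. Qed.

Lemma asc_max s k : n < k -> asc s k = false.
Proof. by move=> lt_nk; rewrite /asc (@entry_gt _ k.+1). Qed.

Definition updown s : seq bool := mkseq (fun k => asc s k.+1) n.

Lemma size_updown s : size (updown s) = n.
Proof. by rewrite size_mkseq. Qed.

(** The default value [false] stands for the final descent, so the formula also covers indices past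
    the end. *)
Lemma nth_updown s k : nth false (updown s) k = asc s k.+1.
Proof.
case: (ltnP k n) => [lt_kn|le_nk]; first by rewrite nth_mkseq.
by rewrite nth_default ?size_updown // asc_max.
Qed.

End Entries.

Section InsertMin.
Local Open Scope nat_scope.
Variables (n : nat) (i : 'I_n.+2) (s : 'S_n.+1).
Local Notation s' := (lift_perm i ord0 s).

(** [lift_perm i ord0 s] puts the least value at the 0-based position i and raises the old values by
    one; [entry] being 1-based, the new entry has index [i.+1]. *)
Lemma entry_lift_min k : entry s' k =
  if k == 0 then 0 else if k <= i then (entry s k).+1
  else if k == i.+1 then 1 else if k <= n.+2 then (entry s k.-1).+1 else 0.
Proof.
case: k => // k; case: (ltnP k n.+2) => [lt_kn|]; last first.
  by have := ltn_ord i => *; rewrite entry_gt //; repeat case: ifP; lia.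
rewrite (entry_ord s' (Ordinal lt_kn)) eqSS /=.
case: (unliftP i (Ordinal lt_kn)) => [j Ej|Ei]; last first.
  by rewrite Ei lift_perm_id -[k]/(nat_of_ord (Ordinal lt_kn)) Ei ltnn eqxx.
rewrite Ej lift_perm_lift lift0; have := congr1 val Ej => /= ->.
rewrite /bump; have lt_j := ltn_ord j; case: (leqP i j) => /= ij.
  by rewrite add1n ltnNge ltnW //= gtn_eqF //= entry_ord.
by rewrite add0n ij entry_ord.
Qed.

(** Old neighbours compare as before. The step into the new minimum is a descent unless it comes
    from the boundary 0; the step out of it is an ascent unless it leads to the boundary 0. *)
Lemma asc_lift_min k : k <= n.+2 -> asc s' k =
  if k < i then asc s k else if k == i then i == ord0
  else if k == i.+1 then i < n.+1 else asc s k.-1.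
Proof.
move=> le_kn; rewrite /asc !entry_lift_min.
have lt_i := ltn_ord i.
have -> : (i == ord0) = (i == 0 :> nat) by [].
case: k le_kn => [|k] /= le_kn.
  have := entry_gt0 s 1; rewrite /= => e1.
  by case: (nat_of_ord i) => [|m] //=; rewrite e1.
have := entry_gt0 s k.+2; have := entry_gt0 s k.+1; have := entry_gt0 s k.
rewrite !eqSS !ltnS.
move: (entry s k) (entry s k.+1) (entry s k.+2) => e0 e1 e2.
move: (nat_of_ord i) lt_i => m lt_m h0 h1 h2.
by repeat case: ifP => ?; lia.
Qed.

Lemma updown_lift_min : updown s' = insert_min (updown s) i.
Proof.
have lt_i := ltn_ord i.
apply: (@eq_from_nth _ false) => [|k].
  by rewrite size_insert_min !size_updown.
rewrite size_updown => lt_k; rewrite nth_updown asc_lift_min; last by lia.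
case: (posnP i) => [i0|i0].
  by rewrite i0 /=; case: k {lt_k} => [|k] //=; rewrite nth_updown.
have -> : insert_min (updown s) i = ins_min (updown s) i.-1.
  by rewrite -[in LHS](prednK i0).
rewrite nth_ins_min ?size_updown; try lia.
rewrite !nth_updown.
have -> : (i == ord0) = false by rewrite -(inj_eq val_inj) /=; lia.
have -> : (k.+1 < i) = (k < i.-1) by lia.
have -> : (k.+1 == i) = (k == i.-1) by lia.
have -> : (k.+1 == i.+1) = (k == i.-1.+1) by lia.
case: ifP => // h1; case: ifP => // h2; case: ifP => [/eqP h3|/eqP h3].
  by lia.
by rewrite prednK //; lia.
Qed.

End InsertMin.

(** * Statistics under insertion of a minimum *)

Lemma card_sum_nat (T : finType) (P : pred T) :
  #|[set x | P x]| = (\sum_x P x)%N.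
Proof. by rewrite -sum1dep_card big_mkcond. Qed.

(** A permutation is determined by the position i of the value j and by the rest; injectivity and a
    cardinality count give the bijection. *)
Lemma big_perm_lift (R : Type) (idx : R) (op : Monoid.com_law idx) n
    (j : 'I_n.+1) (f : 'S_n.+1 -> R) :
  \big[op/idx]_(s : 'S_n.+1) f s =
  \big[op/idx]_(i < n.+1) \big[op/idx]_(s : 'S_n) f (lift_perm i j s).
Proof.
rewrite pair_big /=.
rewrite (reindex (fun p : 'I_n.+1 * 'S_n => lift_perm p.1 j p.2)) //.
apply: onW_bij; apply: inj_card_bij => [[i s] [i' s'] /= e|]; last first.
  by rewrite card_prod !card_Sn card_ord -factS.
have ei : i = i'.
  apply: (@perm_inj _ (lift_perm i j s)).
  by rewrite lift_perm_id [in RHS]e lift_perm_id.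
subst i'; congr (_, _); apply/permP => k; apply: (@lift_inj _ j).
by rewrite -!(lift_perm_lift i) e.
Qed.

Lemma sum_ltn m k : (\sum_(j < m) (j < k) = minn k m)%N.
Proof.
elim: m => [|m IH]; first by rewrite big_ord0 minn0.
by rewrite big_ord_recr /= IH; lia.
Qed.

Section InsertMinStatistics.
Local Open Scope nat_scope.
Variables (n : nat) (i : 'I_n.+2) (s : 'S_n.+1).
Local Notation s' := (lift_perm i ord0 s).

Lemma ltn_lift m (h : 'I_m.+1) (j k : 'I_m) : (lift h j < lift h k) = (j < k).
Proof. by rewrite !ltnNge leq_bump2. Qed.

Lemma lma_lift_min : lma s' = lma s + (i == 0 :> nat).
Proof.
rewrite /lma !card_sum_nat (bigD1_ord i) //= addnC; congr (_ + _); last first.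
  congr nat_of_bool; apply/forallP/eqP => [h|i0 j]; last by rewrite i0.
  apply/eqP; rewrite -leqn0 leqNgt; apply/negP => i_gt0.
  by have /implyP/(_ i_gt0) := h ord0; rewrite lift_perm_id.
apply: eq_bigr => k _; congr nat_of_bool; apply/forallP/forallP => h j.
  by have := h (lift i j); rewrite !lift_perm_lift !ltn_lift.
case: (unliftP i j) => [j' ->|->].
  by rewrite !lift_perm_lift !ltn_lift; exact: h.
by rewrite lift_perm_id lift_perm_lift implybT.
Qed.

Lemma rma_lift_min : rma s' = rma s + (i == n.+1 :> nat).
Proof.
have lt_i := ltn_ord i.
rewrite /rma !card_sum_nat (bigD1_ord i) //= addnC; congr (_ + _); last first.
  congr nat_of_bool; apply/forallP/eqP => [h|i0 j]; last first.
    by rewrite i0 ltnNge -ltnS ltn_ord.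
  apply/eqP; rewrite eqn_leq -ltnS lt_i leqNgt; apply/negP => i_gt0.
  by have /implyP/(_ i_gt0) := h ord_max; rewrite lift_perm_id.
apply: eq_bigr => k _; congr nat_of_bool; apply/forallP/forallP => h j.
  by have := h (lift i j); rewrite !lift_perm_lift !ltn_lift.
case: (unliftP i j) => [j' ->|->].
  by rewrite !lift_perm_lift !ltn_lift; exact: h.
by rewrite lift_perm_id lift_perm_lift implybT.
Qed.

Lemma lma_gt0 : 0 < lma s.
Proof. by apply/card_gt0P; exists ord0; rewrite inE; apply/forallP. Qed.

Lemma rma_gt0 : 0 < rma s.
Proof.
apply/card_gt0P; exists ord_max; rewrite inE; apply/forallP => j /=.
by rewrite ltnNge -ltnS ltn_ord.
Qed.

Lemma inv_lift_min : Defs.inv s' = Defs.inv s + i.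
Proof.
rewrite /Defs.inv !card_sum_nat.
rewrite -(pair_big xpredT xpredT
  (fun a b : 'I_n.+2 => (a < b) && (s' a > s' b) : nat)).
rewrite -(pair_big xpredT xpredT
  (fun a b : 'I_n.+1 => (a < b) && (s a > s b) : nat)) /=.
rewrite (bigD1_ord i) //= big1 => [|j _]; last by rewrite lift_perm_id andbF.
rewrite add0n (eq_bigr (fun k : 'I_n.+1 => (k < i) +
    \sum_(j < n.+1) ((k < j) && (s j < s k)))) => [|k _]; last first.
  rewrite (bigD1_ord i) //= lift_perm_id lift_perm_lift andbT; congr (_ + _).
    congr nat_of_bool; rewrite /bump; case: (leqP i k) => ik //=.
    by rewrite add1n ltnNge ltnW.
  apply: eq_bigr => j _; rewrite lift_perm_lift.
  by rewrite -[bump i _ < _]/(lift i _ < lift i _) !ltn_lift.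
rewrite big_split /= addnC; congr (_ + _).
by rewrite sum_ltn (minn_idPl _) // -ltnS.
Qed.

End InsertMinStatistics.

(** * Local statistics in terms of ascents and descents *)

Section LocalStatistics.
Local Open Scope nat_scope.
Variables (n : nat) (s : 'S_n.+1).

Lemma peaksE : peaks s = \sum_(i < n.+1) (asc s i && ~~ asc s i.+1).
Proof.
rewrite /peaks card_sum_nat; apply: eq_bigr => i _.
by rewrite [entry s i.+2 < _]ltn_entryS.
Qed.

Lemma valleysE : valleys s = \sum_(i < n.+1) (~~ asc s i && asc s i.+1).
Proof.
rewrite /valleys card_sum_nat; apply: eq_bigr => i _.
by rewrite ltn_entryS // ltnW.
Qed.

Lemma dascentsE : dascents s = \sum_(i < n.+1) (asc s i && asc s i.+1).
Proof. by rewrite /dascents card_sum_nat. Qed.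

Lemma ddescentsE : ddescents s = \sum_(i < n.+1) (~~ asc s i && ~~ asc s i.+1).
Proof.
rewrite /ddescents card_sum_nat; apply: eq_bigr => i _.
by rewrite !ltn_entryS // ltnW.
Qed.

(** At each index, peak minus valley is [asc s i - asc s i.+1], which telescopes from the initial
    ascent to the final descent. Adding ascents to both sides avoids subtraction. *)
Lemma peaks_valleys : peaks s = (valleys s).+1.
Proof.
apply: (@addIn (\sum_(i < n.+1) asc s i.+1)).
rewrite peaksE -big_split (eq_bigr (fun i : 'I_n.+1 =>
    (~~ asc s i && asc s i.+1) + asc s i)) => [|i _]; last first.
  by case: (asc s i); case: (asc s i.+1).
rewrite big_split -valleysE addSnnS; congr (_ + _).
have -> : \sum_(i < n.+1) asc s i.+1 = \sum_(i < n) asc s i.+1.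
  by rewrite big_ord_recr /= (asc_max s (leqnn n.+1)) addn0.
by rewrite /= big_ord_recl /=; have := asc0 s => /= ->.
Qed.

End LocalStatistics.

Lemma prod_adjw (L : fieldType) (v u3 u4 : L) n (s : 'S_n.+1) :
  \prod_(i < n.+1) adjw v u3 u4 (asc s i) (asc s i.+1) =
  v ^+ valleys s * u3 ^+ dascents s * u4 ^+ ddescents s.
Proof.
rewrite valleysE dascentsE ddescentsE !expr_sum -!big_split.
apply: eq_bigr => i _ /=; rewrite /adjw.
by case: (asc s i); case: (asc s i.+1); rewrite ?expr0 ?expr1 ?mulr1 ?mul1r.
Qed.

(** * The generating function *)

Section GeneratingFunction.
Variables (L : fieldType) (q v u3 u4 a b : L) (A B C : fps L).
Hypothesis q_neq1 : forall n, q ^+ n.+1 != 1.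
Hypothesis C_qD :
  qD q C = v%:S + u4%:S * dilate q C + u3%:S * C + C * dilate q C.
Hypothesis A_qD : qD q A = A * (a%:S * (u3%:S + dilate q C)).
Hypothesis B_qD : qD q B = dilate q B * (b%:S * (u4%:S + C)).
Hypotheses (A0 : coefs A 0 = 1) (B0 : coefs B 0 = 1) (C0 : coefs C 0 = 0).

Local Notation tail := (tail_series q v u3 u4 B C).
Local Notation word := (word_series q v u3 u4 A B C).
Local Notation adj := (adjw v u3 u4).

(** C has zero constant term, so at t = 0 only the term in which no letter is hit survives. *)
Lemma coefs0_tail_series p c : coefs (tail p c) 0 =
  \prod_(i < (size c).+1) adj (nth false (p :: c) i) (nth false c i).
Proof.
elim: c p => [|x c IH] p; first by rewrite big_ord1 coefsCM B0 mulr1.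
rewrite big_ord_recl -[tail p (x :: c)]/((adj p x)%:S * dilate q (tail x c)
    + (adj p false)%:S * C * dilate q (tail true c)).
rewrite coefsD coefsCM -mulrA coefsCM coefs0M C0 mul0r mulr0 addr0.
by rewrite /= expr0 mul1r IH; congr (_ * _).
Qed.

Lemma coefs0_word_series n (s : 'S_n.+1) : coefs (word (updown s)) 0 =
  v ^+ valleys s * u3 ^+ dascents s * u4 ^+ ddescents s.
Proof.
rewrite coefs0M A0 mul1r /= expr0 mul1r coefs0_tail_series size_updown.
rewrite -prod_adjw.
apply: eq_bigr => -[[|i] lt_i] _ /=; rewrite !nth_updown //.
by have := asc0 s => /= ->.
Qed.

Definition perm_weight n (s : 'S_n.+1) : L :=
  a ^+ (lma s).-1 * b ^+ (rma s).-1 * q ^+ Defs.inv s.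

(** Each larger permutation arises once by inserting a minimum; for a fixed smaller one, the sum
    over the gaps is [word_series_qD]. *)
Lemma sum_word_series_step n k :
  \sum_(s : 'S_n.+2) perm_weight s * coefs (word (updown s)) k =
  qnum q k.+1 * \sum_(s : 'S_n.+1) perm_weight s * coefs (word (updown s)) k.+1.
Proof.
rewrite (big_perm_lift _ ord0) exchange_big mulr_sumr; apply: eq_bigr => s _.
rewrite [RHS]mulrCA -coefs_qD (word_series_qD q_neq1 C_qD A_qD B_qD).
rewrite size_updown.
have coefs_sum m (f : 'I_m -> fps L) :
    coefs (\sum_(i < m) f i) k = \sum_(i < m) coefs (f i) k.
  by elim/big_rec2: _ => // i x y _ <-.
rewrite coefs_sum mulr_sumr; apply: eq_bigr => i _.
rewrite coefsCM updown_lift_min mulrA; congr (_ * _).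
rewrite /perm_weight lma_lift_min rma_lift_min inv_lift_min.
rewrite -(prednK (lma_gt0 s)) -(prednK (rma_gt0 s)) !addSn !exprD /=; ring.
Qed.

(** Each step removes one entry and raises k by one, the q-numbers building up q-factorials, until
    the one-letter permutation is left, whose series is [A(t) B(qt)]. *)
Lemma sum_word_series n k :
  qfact q k * \sum_(s : 'S_n.+1) perm_weight s * coefs (word (updown s)) k =
  qfact q (n + k) * coefs (A * dilate q B) (n + k).
Proof.
elim: n k => [|n IH] k; last first.
  by rewrite sum_word_series_step mulrA -qfactS // IH addSnnS.
congr (_ * _); rewrite (big_pred1 1%g) => [|s]; last first.
  by apply/esym/eqP/permP => i; rewrite !ord1.
have card1 (D : {set 'I_1}) : (#|D|.-1 = 0)%N.
  by have := max_card [in D]; rewrite card_ord; case: #|D| => [|[]].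
rewrite /perm_weight /lma /rma !card1 !mulr1.
have -> : Defs.inv (1%g : 'S_1) = 0%N.
  by apply: eq_card0 => -[i j]; rewrite inE !ord1.
by rewrite -[word _]/(A * dilate q (1%:S * B)) rmorph1 !mul1r.
Qed.

End GeneratingFunction.

(** The case [k = 0] of [sum_word_series]: constant terms are the local weights, and [M = V + 1]
    splits [(u1 * u2)^V]. *)
Lemma sum_P (L : fieldType) (q u1 u2 u3 u4 a b : L) (A B C : fps L) :
  (forall n, q ^+ n.+1 != 1) ->
  qD q C = (u1 * u2)%:S + u4%:S * dilate q C + u3%:S * C + C * dilate q C ->
  qD q A = A * (a%:S * (u3%:S + dilate q C)) ->
  qD q B = dilate q B * (b%:S * (u4%:S + C)) ->
  coefs A 0 = 1 -> coefs B 0 = 1 -> coefs C 0 = 0 ->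
  Fps (fun n => P n.+1 u1 u2 u3 u4 a b q / qfact q n) = A * dilate q B.
Proof.
move=> q1 CE AE BE A0 B0 C0; apply: fpsP => n /=.
apply: (mulfI (qfact_neq0 q1 n)); rewrite mulrC divfK ?qfact_neq0 //.
have := sum_word_series q1 CE AE BE n 0.
rewrite addn0 => <-; rewrite {1}/qfact big_geq // mul1r.
apply: eq_bigr => s _; rewrite coefs0_word_series // peaks_valleys /= exprMn.
rewrite /perm_weight; ring.
Qed.

(** * Infinite products over K(q) *)

Lemma fracE (R : idomainType) (z : {fraction R}) :
  exists c d : R, d != 0 /\ z = tofrac c / tofrac d.
Proof.
elim/quotW: z => x; exists (frac x).1, (frac x).2.
split; first exact: denom_ratioP.
have d0 : tofrac (frac x).2 != 0 by rewrite tofrac_eq0 denom_ratioP.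
apply: (mulIf d0); rewrite divfK //; unlock tofrac.
rewrite -[LHS]FracField.pi_mul; apply/eqP.
rewrite FracField.equivf_def /FracField.mulf.
by rewrite !numden_Ratio ?mulf_neq0 ?oner_neq0 ?denom_ratioP //= !mulr1 mulrC.
Qed.

Lemma cancel_expM (E : fieldType) (c d rm rk rj : E) : rk != 0 -> d != 0 ->
  rm * rk * rj * (c / (d * rk)) = rm * (c * rj / d).
Proof. by move=> rk0 d0; field; rewrite rk0 d0. Qed.

Section Places.
Variable K : fieldType.
Local Notation Kq := {fraction {poly K}}.
Local Notation q := (@qvar K).
Local Notation ev p r := (map_poly (@cst K) p).[r].

Lemma ev_qvar (p : {poly K}) : ev p q = tofrac p.
Proof.
have -> : map_poly (@cst K) p = map_poly (@tofrac _) (map_poly polyC p).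
  by rewrite -map_poly_comp.
by rewrite horner_map -[in RHS](comp_polyXr p).
Qed.

(** The reversed polynomial [X^n p(1/X)], for p of degree at most n. *)
Definition revp n (p : {poly K}) : {poly K} := \poly_(i < n.+1) p`_(n - i).

Lemma revp_neq0 n (p : {poly K}) :
  (size p <= n.+1)%N -> p != 0 -> revp n p != 0.
Proof.
move=> le_pn; apply: contra_neq => rp0; apply/polyP => i; rewrite coef0.
case: (leqP i n) => [le_in|lt_ni]; last first.
  by rewrite nth_default // (leq_trans le_pn).
by have := congr1 (fun r : {poly K} => r`_(n - i)) rp0;
  rewrite coef_poly ltnS leq_subr subKn // coef0.
Qed.

Lemma ev_revp n (p : {poly K}) (r : Kq) : (size p <= n.+1)%N -> r != 0 ->
  ev p r = r ^+ n * ev (revp n p) r^-1.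
Proof.
move=> le_pn r0.
rewrite (@horner_coef_wide _ n.+1) ?size_map_poly //.
rewrite (@horner_coef_wide _ n.+1 (map_poly _ (revp _ _))); last first.
  by rewrite size_map_poly size_poly.
rewrite mulr_sumr (reindex_inj rev_ord_inj); apply: eq_bigr => i _ /=.
have le_in : (i <= n)%N by rewrite -ltnS.
rewrite !coef_map coef_poly ltn_ord subSS mulrCA; congr (_ * _).
have ri0 : r ^+ i != 0 by rewrite expf_neq0.
by apply: (mulIf ri0); rewrite -exprD subnK // exprVn divfK.
Qed.

(** That is, r is transcendental over K and K(r) is all of K(q). Both q and 1/q qualify, so one
    argument serves both places. *)
Definition generator (r : Kq) : Prop :=
  (forall p : {poly K}, p != 0 -> ev p r != 0) /\
  (forall z : Kq, exists c d : {poly K}, d != 0 /\ z = ev c r / ev d r).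

Lemma generator_qvar : generator q.
Proof.
split=> [p p0|z]; first by rewrite ev_qvar tofrac_eq0.
by have [c [d [d0 ->]]] := fracE z; exists c, d; rewrite !ev_qvar.
Qed.

Lemma generator_neq0 r : generator r -> r != 0.
Proof.
by move=> [tr _]; have := tr 'X; rewrite polyX_eq0 map_polyX hornerX; exact.
Qed.

Lemma generatorV r : generator r -> generator r^-1.
Proof.
move=> r_gen; have r0 := generator_neq0 r_gen; have [tr gen] := r_gen.
have rV0 : r^-1 != 0 by rewrite invr_eq0.
split=> [p p0|z].
  rewrite (ev_revp (leqnSn (size p)) rV0) (invrK r).
  by apply: mulf_neq0; [exact: expf_neq0 | apply: tr; exact: revp_neq0].
have [c [d [d0 ->]]] := gen z.
pose n := maxn (size c) (size d).
have le_cn : (size c <= n.+1)%N by rewrite leqW // leq_maxl.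
have le_dn : (size d <= n.+1)%N by rewrite leqW // leq_maxr.
exists (revp n c), (revp n d); split; first exact: revp_neq0.
rewrite (ev_revp le_cn r0) (ev_revp le_dn r0) -mulf_div.
by rewrite (divff (expf_neq0 n r0)) mul1r.
Qed.

Section Convergence.
Variable r : Kq.
Hypothesis r_gen : generator r.

Lemma adic_small0 m : adic_small r m 0.
Proof.
exists 0, 1; rewrite hornerC oner_neq0; split=> //.
by rewrite rmorph0 horner0 mul0r mulr0.
Qed.

Lemma adic_smallD m z z' : adic_small r m z -> adic_small r m z' ->
  adic_small r m (z + z').
Proof.
have [tr _] := r_gen.
move=> [c [d [d0 ->]]] [c' [d' [d'0 ->]]].
have nz e : e.[0] != 0 -> ev e r != 0.
  by move=> e0; apply: tr; apply: contra_neq e0 => ->; rewrite horner0.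
exists (c * d' + c' * d), (d * d'); rewrite hornerM mulf_neq0 //; split=> //.
by rewrite -mulrDr addf_div ?nz // !(rmorphD, rmorphM) /= !(hornerD, hornerM).
Qed.

(** A fixed z has a pole of order at most k at r = 0, where k is the multiplicity of the root 0 in
    the denominator; [N >= m + k] absorbs it. *)
Lemma adic_small_expM m z :
  exists N0, forall N, (N0 <= N)%N -> adic_small r m (r ^+ N * z).
Proof.
have [tr gen] := r_gen; have [c [d [d0 ->]]] := gen z.
have [k [d' d'0 Ed]] := multiplicity_XsubC d 0.
rewrite d0 /= in d'0; rewrite subr0 in Ed.
exists (m + k)%N => N le_N; exists (c * 'X^(N - (m + k))), d'; split=> //.
have r0 : r ^+ k != 0 by rewrite expf_neq0 // generator_neq0.
rewrite Ed !rmorphM /= !hornerM !map_polyXn !hornerXn.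
rewrite -[in LHS](subnKC le_N) !exprD.
have d'r : ev d' r != 0.
  by apply: tr; apply: contraNneq d'0 => ->; rewrite root0.
exact: (cancel_expM _ _ _ r0 d'r).
Qed.

Definition eventually_small m (z : nat -> Kq) : Prop :=
  exists N0, forall N, (N0 <= N)%N -> adic_small r m (z N).

Lemma eventually_small_sum m k (z : 'I_k -> nat -> Kq) :
  (forall i, eventually_small m (z i)) ->
  eventually_small m (fun N => \sum_i z i N).
Proof.
elim: k z => [|k IH] z hz.
  by exists 0%N => N _; rewrite big_ord0; exact: adic_small0.
have [N1 h1] := hz ord0; have [N2 h2] := IH _ (fun i => hz (lift ord0 i)).
exists (maxn N1 N2) => N; rewrite geq_max => /andP[le1 le2].
by rewrite big_ord_recl; apply: adic_smallD; [exact: h1 | exact: h2].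
Qed.

(* The partial products telescope to A(t) / A(r^N t), and the coefficient of
   t^j, j > 0, in 1 / A(r^N t) is divisible by r^(N j) up to a bounded order. *)
Lemma is_infprod_dilate (A g : fps Kq) :
  coefs A 0 = 1 -> A * g = dilate r A ->
  is_infprod r (fun k => (dilate (r ^+ k) g)^-1) A.
Proof.
move=> A0 Ag n m.
have g0 : coefs g 0 = 1.
  have := congr1 (fun f => coefs f 0) Ag.
  by rewrite coefs0M A0 mul1r => ->; rewrite /= mul1r.
have prodE N : \prod_(k < N) (dilate (r ^+ k) g)^-1 * dilate (r ^+ N) A = A.
  elim: N => [|N IH]; first by rewrite big_ord0 mul1r expr0 dilate1.
  rewrite big_ord_recr /= exprSr -dilate_comp -Ag rmorphM /= mulrACA.
  rewrite mulVr ?mulr1 ?IH // fps_unitE /= g0 mulr1.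
  by rewrite expf_neq0 // expf_neq0 // generator_neq0.
have uA : A \is a GRing.unit by rewrite fps_unitE A0 oner_neq0.
pose W := A^-1.
have AW : A * W = 1 by rewrite mulrV.
have W0 : coefs W 0 = 1.
  by have := congr1 (fun f => coefs f 0) AW; rewrite coefs0M A0 mul1r.
have partE N : \prod_(k < N) (dilate (r ^+ k) g)^-1 = A * dilate (r ^+ N) W.
  by rewrite -[in RHS](prodE N) -mulrA -rmorphM AW rmorph1 mulr1.
suff: eventually_small m (fun N => \sum_(i < n.+1)
    coefs A i * coefs (dilate (r ^+ N) W - 1) (n - i)).
  move=> [N0 h]; exists N0 => N le_N; rewrite -coefsB partE.
  by rewrite -[X in _ - X]mulr1 -mulrBr coefsM; exact: h.
apply: eventually_small_sum => i; rewrite /=.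
case: (n - i)%N => [|j].
  exists 0%N => N _; rewrite W0 expr0 mulr1 subrr mulr0; exact: adic_small0.
have [N0 h] := adic_small_expM m (coefs A i * coefs W j.+1).
exists N0 => N le_N; rewrite subr0 -exprM mulrCA; apply: h.
by rewrite mulnS (leq_trans le_N) // leq_addr.
Qed.

End Convergence.
End Places.

(** * Factorization *)

Lemma F_scale (L : fieldType) (u1 u2 x y u q : L) :
  u2%:S * F u1 x y u q = F (u1 * u2) x y u q.
Proof. by rewrite /F rmorphM /= !mulrA [u2%:S * _]mulrC. Qed.

Lemma dilate_linear (L : fieldType) (d c : L) (f : fps L) :
  dilate d (1 - fpsX L * c%:S * f) = 1 - fpsX L * (c * d)%:S * dilate d f.
Proof.
by rewrite rmorphB rmorph1 !rmorphM /= dilateX dilateC; ring.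
Qed.

Section Factorization.
Variables (L : fieldType) (u1 u2 u3 u4 x y a b q : L).
Let C := u2%:S * F u1 x y u4 q.
Let C' := u2%:S * F u1 x y u3 q^-1.

(** Each factor is a dilation of the one at [k = 0], the form in which [is_infprod_dilate]
    telescopes the product. *)
Lemma Ga_dilate k : Ga u1 u2 u3 u4 x y a q k =
  (dilate (q ^+ k) (1 - fpsX L * (a * (1 - q))%:S * (u3%:S + dilate q C)))^-1.
Proof.
rewrite /Ga /C dilate_linear [dilate _ (_ + _)]rmorphD.
rewrite [dilate q (_ * _)]rmorphM /=.
rewrite [dilate _ (_ * _)]rmorphM /= !dilateC dilate_comp -exprSr.
by rewrite [a * (1 - q) * _]mulrAC.
Qed.

Lemma Gb_dilate k : Gb u1 u2 u3 u4 x y b q k =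
  (dilate (q^-1 ^+ k) (1 - fpsX L * (b * (q - 1))%:S * (u4%:S + C')))^-1.
Proof.
rewrite /Gb /C'; move: (F _ _ _ _ _) => f; rewrite dilate_linear.
rewrite [dilate _ (_ + _)]rmorphD /= [dilate _ (_ * _)]rmorphM /= !dilateC.
by rewrite exprVn [b * (q - 1) * _]mulrAC.
Qed.

(** The algebraic half, over any field in which q is nonzero and not a root of unity; the two
    functional equations determine the infinite products later. *)
Lemma P_factorization :
  (forall n, q ^+ n.+1 != 1) -> q != 0 ->
  x + y = u3 + u4 -> x * y = u1 * u2 -> x != y ->
  exists A B : fps L,
  [/\ coefs A 0 = 1 /\
      A * (1 - fpsX L * (a * (1 - q))%:S * (u3%:S + dilate q C)) = dilate q A,
      coefs B 0 = 1 /\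
      B * (1 - fpsX L * (b * (q - 1))%:S * (u4%:S + C')) = dilate q^-1 B
    & Fps (fun n => P n.+1 u1 u2 u3 u4 a b q / qfact q n) = A * B].
Proof.
move=> q1 q0 xyD xyM xy.
have CE : C = F (x * y) x y u4 q by rewrite /C F_scale xyM.
have CE' : C' = C by rewrite CE /C' F_scale -xyM (F_inv q1 q0 xyD xy).
have C0 : coefs C 0 = 0 by rewrite CE; exact: coefs0_F.
have := F_qD q1 xyD xy; rewrite -CE CE' => C_qD.
have [A [A0 A_qD]] := ex_qD_left q1 (a%:S * (u3%:S + dilate q C)).
have [B [B0 B_qD]] := ex_qD_right q1 (b%:S * (u4%:S + C)).
(* The second factor is [B(qt)]; its dilation by 1/q is B, so the linear equation for B relates the
   two. *)
exists A, (dilate q B); move: C C0 C_qD A_qD B_qD => D D0 D_qD A_qD B_qD; split.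
- by split=> //; rewrite [dilate q A]dilate_qD A_qD; ring.
- split; first by rewrite /= expr0 mul1r.
  rewrite dilate_comp mulVf // dilate1.
  apply: (addIr ((q - 1)%:S * fpsX _ * qD q B)); rewrite -dilate_qD B_qD; ring.
- by apply: (@sum_P _ q _ _ _ _ _ _ A B D) => //; rewrite -xyM.
Qed.

End Factorization.

Lemma qvar_expr_neq1 (K : fieldType) n :
  (qvar : {fraction {poly K}}) ^+ n.+1 != 1.
Proof.
rewrite -tofracXn -tofrac1 tofrac_eq.
apply: contra_eq_neq (size_polyXn K n.+1) => ->.
by rewrite size_poly1.
Qed.

Theorem theorem1p4 (K : fieldType) (u1 u2 u3 u4 a b x y : K) :
  x + y = u3 + u4 -> x * y = u1 * u2 -> x != y ->
  let q : {fraction {poly K}} := qvar in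
  exists A B : fps {fraction {poly K}},
    [/\ is_infprod q
          (Ga (cst u1) (cst u2) (cst u3) (cst u4) (cst x) (cst y) (cst a) q) A,
        is_infprod q^-1
          (Gb (cst u1) (cst u2) (cst u3) (cst u4) (cst x) (cst y) (cst b) q) B
      & Fps (fun n => P n.+1 (cst u1) (cst u2) (cst u3) (cst u4)
                        (cst a) (cst b) q / qfact q n) = A * B].
Proof.
move=> xyD xyM xy q.
have q_gen : generator q := generator_qvar K.
have cD : cst x + cst y = cst u3 + cst u4 by rewrite -!rmorphD xyD.
have cM : cst x * cst y = cst u1 * cst u2 by rewrite -!rmorphM xyM.
have cxy : cst x != cst y by rewrite (inj_eq (fmorph_inj _)).
have [A [B [[A0 Ag] [B0 Bg] PE]]] := P_factorization (cst a) (cst b)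
  (@qvar_expr_neq1 K) (generator_neq0 q_gen) cD cM cxy.
exists A, B; split=> //.
- rewrite (funext (Ga_dilate _ _ _ _ _ _ _ _)).
  exact: (is_infprod_dilate q_gen A0 Ag).
- rewrite (funext (Gb_dilate _ _ _ _ _ _ _ _)).
  exact: (is_infprod_dilate (generatorV q_gen) B0 Bg).
Qed.
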